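(* Let $x\in[0,1]$ be a quadratic irrational (an irrational root of a nonzero quadratic polynomial with rational coefficients). Then $\mathcal{I}(x)$ is a rational number.
   Context: For $x\in\mathbb{R}$ let $\{x\}=x-\lfloor x\rfloor$. The interrobang function $\mathcal{I}\colon[0,1]\cap\mathbb{Q}\to\mathbb{R}$ is defined recursively by $\mathcal{I}(0)=0$; $\mathcal{I}(x)=4^{-\lfloor1/x\rfloor}\big(1-2\,\mathcal{I}(\{1/x\})\big)$ if $0<x\le\tfrac12$; and $\mathcal{I}(x)=\tfrac38-\tfrac34\,\mathcal{I}(1/x-1)-\tfrac12\,\mathcal{I}(1-x)$ if $\tfrac12<x\le1$ (well founded by the height $a/b\mapsto|a|+|b|$). It is a fact (proved in the paper) that this function extends uniquely to a continuous strictly increasing function $\mathcal{I}\colon[0,1]\to\mathbb{R}$, which satisfies the same three functional equations for all real $x\in[0,1]$; $\mathcal{I}(x)$ for irrational $x$ refers to this extension. *)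

(* Defs.v *)
From HB Require Import structures.
From mathcomp Require Import all_boot all_order all_algebra.
From mathcomp Require Import all_classical all_reals all_analysis.
Set Implicit Arguments. Unset Strict Implicit. Unset Printing Implicit Defensive.
Import Order.TTheory GRing.Theory Num.Theory.
Local Open Scope ring_scope.

Definition fracq (x : rat) : rat := x - (Num.floor x)%:~R.

(* The recursion of the interrobang function on rationals, with an explicit
   fuel argument.  Each recursive call strictly decreases the height
   a/b |-> |a| + b (in lowest terms), so fuel = height suffices. *)
Fixpoint interrobang_fuel (n : nat) (x : rat) : rat :=
  match n with
  | 0%N => 0
  | n'.+1 =>
    if x == 0 then 0
    else if x <= 2^-1 then
      (4 : rat) ^ (- Num.floor (x^-1)) * (1 - 2 * interrobang_fuel n' (fracq (x^-1)))
    else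
      3 / 8 - 3 / 4 * interrobang_fuel n' (x^-1 - 1)
            - 2^-1 * interrobang_fuel n' (1 - x)
  end.

Definition qheight (x : rat) : nat := (`|numq x| + `|denq x|)%N.

Definition interrobang_rat (x : rat) : rat := interrobang_fuel (qheight x) x.

Definition quadratic_irrational (R : realType) (x : R) : Prop :=
  (exists2 p : {poly rat}, (p != 0) && (size p <= 3)%N
      & root (map_poly (fun q : rat => ratr q) p) x)
  /\ ~ (exists q : rat, x = ratr q).

(* Main.v *)
(* By continuity the functional equations hold at irrational points. With G the
   Gauss map, 1/(1 - x) = 1 + 1/G(x) when x > 1/2, so both cases combine into
     I(x) = c + d I(Gx) + e I(GGx),  c, d, e rational,  |d| + |e| < 1.
   If x is a root of a X^2 + b X + c and k is the floor of 1/x, then G(x) is a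
   root of c X^2 + (b + 2ck) X + (ck^2 + bk + a), with the same discriminant.
   Either |c| < |a|, or the new form has outer coefficients of opposite signs;
   descent on |a| reaches the second case. The roots of such forms with a given
   discriminant form a finite G-invariant set, on which the values of I solve a
   rational linear system that is invertible because it is contracting. *)

Require Import Defs.
From HB Require Import structures.
From mathcomp Require Import all_boot all_order all_algebra.
From mathcomp Require Import all_classical all_reals all_analysis.
From mathcomp Require Import ring lra zify.
Import Order.TTheory GRing.Theory Num.Theory.
Import numFieldNormedType.Exports.
Local Open Scope ring_scope.
Local Open Scope classical_set_scope.
Set Implicit Arguments.
Unset Strict Implicit.
Unset Printing Implicit Defensive.

(** * Heights, and the functional equations on the rationals *)

(** Reducing a fraction divides both terms by a common factor, so height bounds may be read off from
    unreduced fractions. *)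
Lemma qheight_divz (n d : int) : d != 0 -> (qheight (n%:~R / d%:~R) <= `|n| + `|d|)%N.
Proof.
case: divqP => [_|k x k0 _]; first by rewrite eqxx.
by rewrite /qheight !abszM -mulnDr leq_pmull // absz_gt0.
Qed.

Lemma qheight_fracE (x : rat) : exists n d : int,
  [/\ 0 < d, x = n%:~R / d%:~R & qheight x = (`|n| + `|d|)%N].
Proof.
by exists (numq x), (denq x); rewrite divq_num_den denq_gt0.
Qed.

(** For x = n/d this is one step of the Euclidean algorithm: the pair (n, d) becomes (d mod n,
    n). *)
Lemma qheight_gauss (x : rat) :
  0 < x <= 2^-1 -> (qheight (Defs.fracq x^-1) < qheight x)%N.
Proof.
have [n [d [d0 xE ->]]] := qheight_fracE x; rewrite xE => /andP[h1 h2].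
have d0' : 0 < d%:~R :> rat by rewrite ltr0z.
have n0 : 0 < n by move: h1; rewrite pmulr_lgt0 ?invr_gt0 // ltr0z.
have n0' : 0 < n%:~R :> rat by rewrite ltr0z.
have nd : n < d.
  by rewrite -(ltr_int rat); move: h2; rewrite ler_pdivrMr// => ?; lra.
rewrite /Defs.fracq invf_div; set k := Num.floor _.
have /andP[] := floor_itv (d%:~R / n%:~R : rat); rewrite -/k.
rewrite ler_pdivlMr// ltr_pdivrMr// -!intrM ler_int ltr_int => k1 k2.
have -> : d%:~R / n%:~R - k%:~R = (d - k * n)%:~R / n%:~R :> rat.
  by rewrite intrB intrM; field; rewrite gt_eqF.
apply: leq_ltn_trans (qheight_divz _ _) _; first by rewrite gt_eqF.
lia.
Qed.

Lemma qheight_invB1 (x : rat) :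
  2^-1 < x <= 1 -> (qheight (x^-1 - 1) < qheight x)%N.
Proof.
have [n [d [d0 xE ->]]] := qheight_fracE x; rewrite xE => /andP[h1 h2].
have d0' : 0 < d%:~R :> rat by rewrite ltr0z.
have n0 : 0 < n.
  by rewrite -(ltr_int rat); move: h1; rewrite ltr_pdivlMr// => ?; lra.
have nd : n <= d.
  by rewrite -(ler_int rat); move: h2; rewrite ler_pdivrMr// => ?; lra.
have -> : (n%:~R / d%:~R)^-1 - 1 = (d - n)%:~R / n%:~R :> rat.
  by rewrite intrB; field; rewrite !intr_eq0 !gt_eqF.
apply: leq_ltn_trans (qheight_divz _ _) _; first by rewrite gt_eqF.
lia.
Qed.

Lemma qheight_1B (x : rat) :
  2^-1 < x <= 1 -> (qheight (1 - x) < qheight x)%N.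
Proof.
have [n [d [d0 xE ->]]] := qheight_fracE x; rewrite xE => /andP[h1 h2].
have d0' : 0 < d%:~R :> rat by rewrite ltr0z.
have n0 : d < 2 * n.
  by rewrite -(ltr_int rat) intrM; move: h1; rewrite ltr_pdivlMr// => ?; lra.
have nd : n <= d.
  by rewrite -(ler_int rat); move: h2; rewrite ler_pdivrMr// => ?; lra.
have -> : 1 - n%:~R / d%:~R = (d - n)%:~R / d%:~R :> rat.
  by rewrite intrB; field; rewrite gt_eqF.
apply: leq_ltn_trans (qheight_divz _ _) _; first by rewrite gt_eqF.
lia.
Qed.

Lemma fracq_ge0_le1 (x : rat) : 0 <= Defs.fracq x <= 1.
Proof.
by have /andP[] := floor_itv x; rewrite /Defs.fracq intrD => ? ?; apply/andP; split; lra.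
Qed.

Lemma invB1_ge0_le1 (x : rat) : 2^-1 < x <= 1 -> 0 <= x^-1 - 1 <= 1.
Proof.
move=> /andP[h1 h2]; have x0 : 0 < x by lra.
by rewrite subr_ge0 lerBlDr invf_ge1// h2 invf_ple ?posrE// ltW.
Qed.

(** Recursive calls stay in [0, 1] and strictly lower the height, which is always positive, so
    sufficient fuel never runs out. *)
Lemma interrobang_fuelE (n : nat) (x : rat) :
  0 <= x <= 1 -> (qheight x <= n)%N -> interrobang_fuel n x = interrobang_rat x.
Proof.
(* Two sufficient fuels are compared, by induction on a bound [m] for their sum. *)
suff H m : forall n n' (y : rat), (n + n' <= m)%N -> 0 <= y <= 1 ->
    (qheight y <= n)%N -> (qheight y <= n')%N ->
    interrobang_fuel n y = interrobang_fuel n' y.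
  by move=> x01 hn; apply: (H _ n (qheight x) x (leqnn _)).
have h0 z : (0 < qheight z)%N.
  by rewrite /qheight addn_gt0 !absz_gt0 denq_eq0 orbT.
elim: m => [|m IH] {x}{}n n' x nm x01 hn hn'.
  by have := h0 x; lia.
case: n hn nm => [|n] hn nm; first by have := h0 x; lia.
case: n' hn' nm => [|n'] hn' nm; first by have := h0 x; lia.
rewrite /=; case: eqVneq => // xn0; case: leP => hx.
  have f01 := fracq_ge0_le1 x^-1.
  have hh : (qheight (Defs.fracq x^-1) < qheight x)%N.
    apply: qheight_gauss; rewrite lt_neqAle eq_sym xn0 hx.
    by case/andP: x01 => ->.
  rewrite (IH n n') //; lia.
have hx1 : 2^-1 < x <= 1 by rewrite hx; case/andP: x01.
have h1 := qheight_1B hx1; have h2 := qheight_invB1 hx1.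
have h3 := invB1_ge0_le1 hx1.
rewrite (IH n n' (x^-1 - 1)) //; [|lia..].
by rewrite (IH n n' (1 - x)) //; try lia; apply/andP; split; lra.
Qed.

Lemma interrobang_rat_small (x : rat) : 0 < x <= 2^-1 ->
  interrobang_rat x =
  4 ^ (- Num.floor x^-1) * (1 - 2 * interrobang_rat (Defs.fracq x^-1)).
Proof.
move=> hx; have h := qheight_gauss hx; rewrite {1}/interrobang_rat.
case: (qheight x) h => // n h /=.
case/andP: hx => x0 x2; rewrite gt_eqF// x2 interrobang_fuelE //.
exact: fracq_ge0_le1.
Qed.

Lemma interrobang_rat_large (x : rat) : 2^-1 < x <= 1 ->
  interrobang_rat x =
  3 / 8 - 3 / 4 * interrobang_rat (x^-1 - 1) - 2^-1 * interrobang_rat (1 - x).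
Proof.
move=> hx; have h1 := qheight_invB1 hx; have h2 := qheight_1B hx.
have h3 := invB1_ge0_le1 hx; rewrite {1}/interrobang_rat.
case: (qheight x) h1 h2 => // n h1 h2 /=.
case/andP: hx => x2 x1; rewrite gt_eqF; last by lra.
rewrite leNgt x2 /= !interrobang_fuelE //.
by apply/andP; split; lra.
Qed.

(** * Contracting linear systems with rational coefficients *)

(** The system reads (1 - A) v = c with A and c rational. Once 1 - A is invertible over the
    rationals, v is the image of the rational vector (1 - A)^-1 c. *)
Lemma contracting_system_rational (R : realFieldType) (n : nat) (v : 'I_n -> R) :
  (forall i, exists (j k : 'I_n) (c d e : rat), `|d| + `|e| < 1 /\
     v i = ratr c + ratr d * v j + ratr e * v k) ->
  forall i, exists q : rat, v i = ratr q.
Proof.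
move=> /choice[j] /choice[k] /choice[c] /choice[d] /choice[e] H i.
(* Written as a sum of indicators so that the coefficients add up when [j i = k i]. *)
pose A : 'M[rat]_n := \matrix_(i, l) (d i *+ (l == j i) + e i *+ (l == k i)).
(* Stated for any morphism: [idfun] serves for the kernel vector, [ratr] for [v]. *)
have sumE (S : fieldType) (f : {rmorphism rat -> S}) (u : 'I_n -> S) l :
    \sum_m f (A l m) * u m = f (d l) * u (j l) + f (e l) * u (k l).
  under eq_bigr => m _ do rewrite mxE rmorphD /= !rmorphMn /= mulrDl !mulrnAl.
  rewrite big_split /=; congr (_ + _).
    rewrite (bigD1 (j l)) //= eqxx big1 ?addr0 // => m /negPf ->; exact: mulr0n.
  rewrite (bigD1 (k l)) //= eqxx big1 ?addr0 // => m /negPf ->; exact: mulr0n.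
have uA : (1%:M - A)%R \in unitmx.
  (* [det0P] yields a left kernel vector; transposing makes it a right one, that is, a fixed vector
     of A. *)
  rewrite unitmxE -det_tr unitfE; apply/negP => /det0P[u un0].
  move=> /rowP uE.
  have fixE l : u 0 l = d l * u 0 (j l) + e l * u 0 (k l).
    have := uE l; rewrite !mxE.
    under eq_bigr => m _ do rewrite !mxE mulrBr.
    rewrite sumrB => /eqP; rewrite subr_eq0 => /eqP.
    rewrite (bigD1 l) //= eqxx mulr1 big1 ?addr0; last first.
      by move=> m ml; rewrite eq_sym (negPf ml) mulr0.
    move=> ->; have /= <- := sumE rat idfun (u 0) l.
    by apply: eq_bigr => m _; rewrite !mxE mulrC.
  have [l0 ul0] : exists l, u 0 l != 0.
    apply/existsP; apply: contraNT un0 => /existsPn h; apply/eqP/rowP => l.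
    by rewrite mxE; apply/eqP; rewrite -[_ == _]negbK h.
  (* At a coordinate of maximal absolute value, the fixed-point equation contradicts |d| + |e| <
     1. *)
  have [l _ lmax] := @arg_maxP _ _ _ l0 xpredT (fun l => `|u 0 l|) isT.
  have [h _] := H l.
  have ul : 0 < `|u 0 l| by apply: lt_le_trans (lmax l0 isT); rewrite normr_gt0.
  have : `|u 0 l| <= (`|d l| + `|e l|) * `|u 0 l|.
    rewrite {1}fixE; apply: le_trans (ler_normD _ _) _; rewrite !normrM mulrDl.
    by apply: lerD; apply: ler_wpM2l => //; apply: lmax.
  by rewrite leNgt -{2}[`|u 0 l|]mul1r ltr_pM2r // h.
have vE : map_mx (ratr : rat -> R) (1%:M - A) *m (\col_l v l) = map_mx ratr (\col_l c l).
  apply/colP => l; rewrite !mxE.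
  under eq_bigr => m _ do rewrite !mxE rmorphB /= mulrBl.
  rewrite sumrB.
  rewrite (bigD1 l) //= eqxx rmorph1 mul1r big1 ?addr0; last first.
    by move=> m ml; rewrite eq_sym (negPf ml) rmorph0 mul0r.
  have /= := sumE R ratr v l.
  under eq_bigr => m _ do rewrite !mxE.
  by move=> ->; have [_ ->] := H l; ring.
exists ((invmx (1%:M - A) *m (\col_l c l)) i 0).
have : (\col_l v l) = map_mx (ratr : rat -> R) (invmx (1%:M - A) *m \col_l c l).
  by rewrite map_mxM -vE mulmxA -map_mxM mulVmx // map_mx1 mul1mx.
by move=> /colP/(_ i); rewrite !mxE.
Qed.

(** * The Gauss map on irrationals of the unit interval *)

Definition irrational01 (R : realType) (x : R) : Prop :=
  0 < x < 1 /\ ~ (exists q : rat, x = ratr q).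

Definition gauss (R : realType) (x : R) : R := x^-1 - (Num.floor x^-1)%:~R.

Lemma floor_inv_gt0 (R : realType) (x : R) :
  irrational01 x -> 0 < Num.floor x^-1.
Proof.
by move=> [/andP[x0 x1] _]; rewrite floor_gt0 invf_ge1 // ltW.
Qed.

Lemma gauss_irrational01 (R : realType) (x : R) :
  irrational01 x -> irrational01 (gauss x).
Proof.
move=> [/andP[x0 x1] xq].
have nq : ~ (exists q : rat, gauss x = ratr q).
  case=> q hq; apply: xq; exists (q + (Num.floor x^-1)%:~R)^-1.
  by rewrite fmorphV rmorphD /= ratr_int -hq subrK invrK.
split=> //; have /andP[] := floor_itv x^-1; rewrite intrD => h1 h2.
rewrite lt_neqAle; apply/andP; split; last by rewrite /gauss; lra.
apply/andP; split; last by rewrite /gauss; lra.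
by apply/eqP => h; apply: nq; exists 0; rewrite rmorph0 -h.
Qed.

(** Strictness on both sides puts x inside an open interval on which the floor of 1/x is
    constant. *)
Lemma irrational01_floor_itv (R : realType) (x : R) : irrational01 x ->
  (Num.floor x^-1)%:~R < x^-1 < (Num.floor x^-1 + 1)%:~R.
Proof.
by move=> /gauss_irrational01[]; rewrite /gauss intrD => /andP[h1 h2] _; apply/andP; split; lra.
Qed.

(** * Functional equations at irrational points, by density and continuity *)

(** If h x were nonzero, h would be nonzero on an open neighbourhood of x inside ]a, b[, which
    contains a rational. *)
Lemma eq0_from_rationals (R : realType) (h : R -> R) (a b x : R) :
  a < x < b -> {for x, continuous h} ->
  (forall q : rat, a < ratr q < b -> h (ratr q) = 0) -> h x = 0.
Proof.
move=> xab hc hq; apply/eqP; apply: contraT => hx0.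
have hn : \forall y \near x, h y != 0 by apply: (cvgr_neq0 (F := nbhs x)) hx0; exact: hc.
have hi : \forall y \near x, y \in `]a, b[%R.
  by apply: (@near_in_itvoo R a b); rewrite in_itv.
have [A /= [oA xA] hA] : exists2 A : set R, open_nbhs x A &
    A `<=` [set y | h y != 0 /\ y \in `]a, b[%R].
  have : nbhs x [set y | h y != 0 /\ y \in `]a, b[%R] by apply: filterI.
  by rewrite nbhsE.
have [y [/hA[]]] : A `&` range ratr !=set0 by apply: dense_rat => //; exists x.
move=> hy yab [q _ qy]; move: hy yab; rewrite -qy in_itv /= => hy /hq.
by move=> e; rewrite e eqxx in hy.
Qed.

Lemma expr4N_le (k : int) : 2 <= k -> 0 < (4 : rat) ^ (- k) <= 16^-1.
Proof.
case: k => // n; rewrite lez_nat => n2; rewrite -exprnN invr_gt0 exprn_gt0 //=.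
rewrite lef_pV2 ?posrE ?exprn_gt0 //.
by rewrite (_ : 16 = 4 ^+ 2) // ler_weXn2l.
Qed.

(** The floor of 1/y equals k for all y in ]1/(k+1), 1/k[, so there the difference of the two sides
    is continuous, and it vanishes at rationals. *)
Lemma interrobang_small (R : realType) (I : R -> R)
  (hcont : {within `[0, 1], continuous I})
  (hrat : forall q : rat, 0 <= q <= 1 -> I (ratr q) = ratr (interrobang_rat q))
  (x : R) (k : int) : 2 <= k -> k%:~R < x^-1 < (k + 1)%:~R ->
  I x = ratr (4 ^ (- k)) * (1 - 2 * I (x^-1 - k%:~R)).
Proof.
move=> k2 hx; apply/eqP; rewrite -subr_eq0; apply/eqP.
(* Continuity within [0, 1] is ordinary continuity at interior points, where all arguments of [I]
   lie. *)
have [ci _ _] := (continuous_within_itvP I ltr01).1 hcont.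
have k2' : 2 <= k%:~R :> R by rewrite (_ : 2 = 2%:~R) // ler_int.
(* For y <= 0 both sides are false, since k >= 2. *)
have itvV (y : R) : ((k + 1)%:~R^-1 < y < k%:~R^-1) = (k%:~R < y^-1 < (k + 1)%:~R).
  case: (ltP 0 y) => y0; last first.
    have yV : y^-1 <= 0 by rewrite invr_le0.
    rewrite (le_gtF (_ : y <= _)) /=; last first.
      by apply: le_trans y0 _; rewrite invr_ge0 ler0z; lia.
    by rewrite (le_gtF (_ : y^-1 <= _)) //; lra.
  have k0 : 0 < k%:~R :> R by lra.
  have k10 : 0 < (k + 1)%:~R :> R by rewrite intrD; lra.
  by rewrite andbC invf_plt ?posrE // invf_pgt ?posrE.
have x0 : 0 < x by rewrite -invr_gt0; case/andP: hx; lra.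
apply: (@eq0_from_rationals _
  (fun x => I x - ratr (4 ^ (- k)) * (1 - 2 * I (x^-1 - k%:~R)))
  (k + 1)%:~R^-1 k%:~R^-1); first by rewrite itvV.
  apply: continuousB.
    apply: ci; rewrite in_itv /= x0 /=.
    by move: hx; rewrite -itvV => /andP[_ /lt_trans]; apply; rewrite invf_lt1 //; lra.
  apply: continuousM; first exact: cst_continuous.
  apply: continuousB; first exact: cst_continuous.
  apply: continuousM; first exact: cst_continuous.
  apply: (@continuous_comp _ _ _ (fun x : R => x^-1 - k%:~R) I).
    apply: continuousB; last exact: cst_continuous.
    by apply: inv_continuous; rewrite gt_eqF.
  apply: ci; rewrite in_itv /=; move: hx; rewrite intrD => /andP[? ?]; apply/andP; split; lra.
move=> q; rewrite itvV => hq.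
have hq' : k%:~R < q^-1 < (k + 1)%:~R.
  by move: hq; rewrite -fmorphV -!(ratr_int R) !ltr_rat.
have fq : Num.floor q^-1 = k.
  by apply: floor_def; case/andP: hq' => /ltW -> ->.
have k2q : 2 <= k%:~R :> rat by rewrite (_ : 2 = 2%:~R) // ler_int.
have q0 : 0 < q by rewrite -invr_gt0; case/andP: hq'; lra.
have q2 : q <= 2^-1 by rewrite -[q]invrK lef_pV2 ?posrE ?invr_gt0 //; case/andP: hq'; lra.
rewrite hrat; last by apply/andP; split; lra.
rewrite interrobang_rat_small ?q0 // fq.
have -> : (ratr q)^-1 - k%:~R = ratr (Defs.fracq q^-1) :> R.
  by rewrite /Defs.fracq fq rmorphB /= fmorphV ratr_int.
rewrite hrat ?fracq_ge0_le1 //.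
by rewrite rmorphM /= rmorphB /= rmorph1 rmorphM /= ratr_nat subrr.
Qed.

Lemma interrobang_large (R : realType) (I : R -> R)
  (hcont : {within `[0, 1], continuous I})
  (hrat : forall q : rat, 0 <= q <= 1 -> I (ratr q) = ratr (interrobang_rat q))
  (x : R) : 2^-1 < x < 1 ->
  I x = 3 / 8 - 3 / 4 * I (x^-1 - 1) - 2^-1 * I (1 - x).
Proof.
move=> hx; apply/eqP; rewrite -subr_eq0; apply/eqP.
have [ci _ _] := (continuous_within_itvP I ltr01).1 hcont.
have x0 : 0 < x by case/andP: hx; lra.
apply: (@eq0_from_rationals _
  (fun x => I x - (3 / 8 - 3 / 4 * I (x^-1 - 1) - 2^-1 * I (1 - x))) 2^-1 1) => //.
  apply: continuousB.
    by apply: ci; rewrite in_itv /= x0 /=; case/andP: hx.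
  apply: continuousB; first (apply: continuousB; first exact: cst_continuous).
    apply: continuousM; first exact: cst_continuous.
    apply: (@continuous_comp _ _ _ (fun x : R => x^-1 - 1) I).
      apply: continuousB; last exact: cst_continuous.
      by apply: inv_continuous; rewrite gt_eqF.
    apply: ci; rewrite in_itv /= subr_gt0 ltrBlDr invf_gt1// invf_plt ?posrE //.
    by case/andP: hx => -> ->.
  apply: continuousM; first exact: cst_continuous.
  apply: (@continuous_comp _ _ _ (fun x : R => 1 - x) I).
    by apply: continuousB; [exact: cst_continuous | exact: cvg_id].
  by apply: ci; rewrite in_itv /=; case/andP: hx => ? ?; apply/andP; split; lra.
move=> q /andP[q1 q2].
have q1' : 2^-1 < q by move: q1; rewrite -(ratr_nat R 2) -fmorphV ltr_rat.
have q2' : q < 1 by move: q2; rewrite -(rmorph1 (ratr : rat -> R)) ltr_rat.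
have q2'' : q <= 1 by apply: ltW.
rewrite hrat; last by apply/andP; split; lra.
rewrite interrobang_rat_large ?q1' //.
have -> : (ratr q)^-1 - 1 = ratr (q^-1 - 1) :> R by rewrite rmorphB /= rmorph1 fmorphV.
have -> : 1 - ratr q = ratr (1 - q) :> R by rewrite rmorphB /= rmorph1.
rewrite !hrat; [|by apply/andP; split; lra|by apply: invB1_ge0_le1; rewrite q1'].
apply/eqP; rewrite subr_eq0; apply/eqP.
rewrite 2!rmorphB !rmorphM !fmorphV !rmorph_nat; congr (_ - _ * _ - _ * _).
Qed.

(** Let k be the floor of 1/x. For k >= 2 the small equation suffices, with |d| <= 1/8. For k = 1
    the term I(1 - x) is expanded by the small equation, giving |d| + |e| <= 3/4 + 1/16. *)
Lemma interrobang_contraction (R : realType) (I : R -> R)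
  (hcont : {within `[0, 1], continuous I})
  (hrat : forall q : rat, 0 <= q <= 1 -> I (ratr q) = ratr (interrobang_rat q))
  (x : R) : irrational01 x ->
  exists c d e : rat, `|d| + `|e| < 1 /\
    I x = ratr c + ratr d * I (gauss x) + ratr e * I (gauss (gauss x)).
Proof.
move=> ix; have hk := irrational01_floor_itv ix; have k0 := floor_inv_gt0 ix.
have [/andP[x0 x1] _] := ix.
case: (leP 2 (Num.floor x^-1)) => k2.
  have hI := interrobang_small hcont hrat k2 hk; have := expr4N_le k2.
  rewrite {}hI -/(gauss x); set c := 4 ^ _ => /andP[c0 c1].
  exists c, (- (2 * c)), 0; split.
    by rewrite normr0 normrN ger0_norm; lra.
  by rewrite rmorph0 rmorphN rmorphM /= ratr_nat; ring.
have k1 : Num.floor x^-1 = 1 by lia.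
have gE : gauss x = x^-1 - 1 by rewrite /gauss k1.
have ig := gauss_irrational01 ix; have hl := irrational01_floor_itv ig.
have l0 := floor_inv_gt0 ig; have [/andP[g0 g1] _] := ig.
set l := Num.floor _ in hl l0.
have x2 : 2^-1 < x.
  by move: hk; rewrite k1 => /andP[_]; rewrite invf_plt ?posrE.
(* Hence the floor of 1/(1 - x) is l + 1 >= 2, and its fractional part is that of 1/G(x), namely
   G(G(x)). *)
have xV : (1 - x)^-1 = (gauss x)^-1 + 1.
  have x1n0 : 1 - x != 0 by rewrite subr_eq0 gt_eqF.
  have -> : gauss x = (1 - x) / x by rewrite gE mulrBl mul1r divff ?gt_eqF.
  by rewrite invf_div -[X in _ = _ + X](divff x1n0) -mulrDl addrCA subrr addr0 mul1r.
have l2 : 2 <= l + 1 by lia.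
have hl' : (l + 1)%:~R < (1 - x)^-1 < (l + 1 + 1)%:~R.
  by move: hl; rewrite xV !intrD => /andP[? ?]; apply/andP; split; lra.
have := interrobang_small hcont hrat l2 hl'; have := expr4N_le l2.
have -> : (1 - x)^-1 - (l + 1)%:~R = gauss (gauss x).
  by rewrite xV [RHS]/gauss -/l intrD; ring.
set c := 4 ^ _ => /andP[c0 c1] hI.
exists (3 / 8 - 2^-1 * c), (- (3 / 4)), c; split.
  by rewrite normrN !ger0_norm; lra.
rewrite (interrobang_large hcont hrat) ?x2 // hI -gE.
rewrite rmorphB rmorphN !rmorphM !fmorphV !rmorph_nat /=.
by field.
Qed.

(** * Integer quadratic equations under the Gauss map *)

Definition quad_root (R : realType) (a b c : int) (x : R) : Prop :=
  a%:~R * x ^+ 2 + b%:~R * x + c%:~R = 0.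

(** Substitute x = 1/(k + G(x)) and clear denominators. *)
Lemma quad_root_gauss (R : realType) (a b c : int) (x : R) :
  irrational01 x -> quad_root a b c x ->
  let k := Num.floor x^-1 in
  quad_root c (b + 2 * c * k) (c * k ^+ 2 + b * k + a) (gauss x).
Proof.
move=> [/andP[x0 _] _] hr k; rewrite /quad_root /gauss -/k.
rewrite !(intrD, intrM, rmorphXn) /=.
have xn0 : x != 0 by rewrite gt_eqF.
apply: (mulfI (expf_neq0 2 xn0)); rewrite mulr0 -[RHS]hr; field.
exact: xn0.
Qed.

(** If c = 0 the equation factors as x (a x + b) = 0, which makes x rational. *)
Lemma quad_root_coef_neq0 (R : realType) (a b c : int) (x : R) :
  irrational01 x -> quad_root a b c x -> a != 0 -> c != 0.
Proof.
move=> [/andP[x0 _] xq] hr a0; apply/eqP => c0; apply: xq.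
exists (- b%:~R / a%:~R); move: hr; rewrite /quad_root c0 addr0.
rewrite expr2 mulrA -mulrDl => /eqP; rewrite mulf_eq0 (gt_eqF x0) orbF => /eqP h.
rewrite rmorphM /= fmorphV rmorphN /= !ratr_int.
apply: (@mulfI _ a%:~R); rewrite ?intr_eq0 // mulrCA divff ?intr_eq0 // mulr1.
by apply/eqP; rewrite -addr_eq0 h.
Qed.

(* With z = 1/x, the root equation gives
   z * c * (c k^2 + b k + a) = (k - z) * (c^2 k z - a c). *)
Lemma quad_root_gauss_signs (R : realType) (a b c : int) (x : R) :
  irrational01 x -> quad_root a b c x -> c != 0 -> a * c <= c ^+ 2 ->
  c * (c * Num.floor x^-1 ^+ 2 + b * Num.floor x^-1 + a) < 0.
Proof.
move=> ix hr c0 ac; set k := Num.floor x^-1; have k0 := floor_inv_gt0 ix.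
have /andP[kz _] := irrational01_floor_itv ix.
have [/andP[x0 x1] _] := ix.
rewrite -/k in k0 kz; rewrite -(ltr_int R) !(intrD, intrM, rmorphXn) /=.
have z1 : 1 < x^-1 by rewrite invf_gt1.
have ac' : a%:~R * c%:~R <= c%:~R ^+ 2 :> R by rewrite -rmorphXn -intrM ler_int.
have c2 : 0 < c%:~R ^+ 2 :> R by rewrite exprn_even_gt0 //= intr_eq0.
have k1 : 1 <= k%:~R :> R by rewrite ler1z; lia.
set z := x^-1 in z1 kz *.
have hz : c%:~R * z ^+ 2 + b%:~R * z + a%:~R = 0.
  apply: (mulfI (expf_neq0 2 (lt0r_neq0 x0))); rewrite mulr0 -[RHS]hr /z.
  by field; rewrite gt_eqF.
have z0 : 0 < z by lra.
rewrite -(pmulr_rlt0 _ z0).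
have -> : z * (c%:~R * (c%:~R * k%:~R ^+ 2 + b%:~R * k%:~R + a%:~R)) =
   (k%:~R - z) * (c%:~R ^+ 2 * (k%:~R * z) - a%:~R * c%:~R)
   + k%:~R * c%:~R * (c%:~R * z ^+ 2 + b%:~R * z + a%:~R) by ring.
(* As k < z, the other factor must be positive: c^2 k z > c^2 >= a c, because k z > 1. *)
rewrite hz mulr0 addr0 nmulr_rlt0; last lra.
have kz1 : 1 < k%:~R * z by nra.
nra.
Qed.

(** * Roots of forms whose outer coefficients have opposite signs *)

(** The condition a c < 0 turns the discriminant into b^2 + 4 |a c| = D, which bounds every
    coefficient. *)
Definition indefinite_root (R : realType) (D : int) (x : R) : Prop :=
  irrational01 x /\ exists a b c : int,
    [/\ quad_root a b c x, a * c < 0 & b ^+ 2 - 4 * a * c = D].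

Lemma indefinite_root_gauss (R : realType) (D : int) (x : R) :
  indefinite_root D x -> indefinite_root D (gauss x).
Proof.
move=> [ix [a [b [c [hr ac hD]]]]]; split; first exact: gauss_irrational01.
have c0 : c != 0 by apply: contraTneq ac => ->; rewrite mulr0.
exists c, (b + 2 * c * Num.floor x^-1),
  (c * Num.floor x^-1 ^+ 2 + b * Num.floor x^-1 + a).
split; first exact: quad_root_gauss.
  by apply: quad_root_gauss_signs => //; apply: le_trans (ltW ac) (sqr_ge0 _).
by rewrite -hD; ring.
Qed.

(** Both |a| and |b| are at most |D|, and a root is determined by a, b, D and a choice of sign. *)
Lemma indefinite_roots_finite (R : realType) (D : int) :
  exists s : seq R, forall x, x \in s <-> indefinite_root D x.
Proof.
pose N := `|D|%N.
pose rng := [seq (n%:Z - N%:Z) | n <- iota 0 (2 * N).+1].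
have rngP (m : int) : `|m| <= N -> m \in rng.
  move=> mN; apply/mapP; exists (absz (m + N)); last by lia.
  by rewrite mem_iota; lia.
(* One sign of the square root is enough: the other root for (a, b) is this one for (-a, -b). *)
pose root (a b : int) : R := (Num.sqrt D%:~R - b%:~R) / (2 * a%:~R).
(* Filtering makes the list exact, hence stable under [gauss]; it also removes the default value 0
   arising from a = 0. *)
exists [seq x <- [seq root a b | a <- rng, b <- rng] | `[< indefinite_root D x >] ].
move=> x; rewrite mem_filter; split=> [/andP[/asboolP]//|hx].
apply/andP; split; first exact/asboolP.
have [_ [a [b [c [hr ac hD]]]]] := hx.
have a_le : `|a| <= - (a * c).
  rewrite -(ltr0_norm ac) normrM ler_peMr // -gtz0_ge1 normr_gt0.
  by apply: contraTneq ac => ->; rewrite mulr0.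
have b_le : `|b| <= b ^+ 2.
  by case: (lerP 0 b) => ?; rewrite expr2; nia.
have DE : D = b ^+ 2 - 4 * (a * c) by rewrite -hD mulrA.
have b2 := sqr_ge0 b.
have aN : `|a| <= N by rewrite /N; lia.
have bN : `|b| <= N by rewrite /N; lia.
have a0 : a%:~R != 0 :> R by rewrite intr_eq0; apply: contraTneq ac => ->; rewrite mul0r.
have : (2 * a%:~R * x + b%:~R) ^+ 2 = D%:~R :> R.
  rewrite -hD intrB !intrM.
  have -> : c%:~R = - (a%:~R * x ^+ 2 + b%:~R * x) :> R.
    by apply/eqP; rewrite -addr_eq0 addrC; exact/eqP.
  by ring.
move=> /(congr1 Num.sqrt); rewrite sqrtr_sqr; case: (ger0P _) => _ hs.
  have -> : x = root a b by rewrite /root -hs; field.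
  by apply: allpairs_f; apply: rngP.
have -> : x = root (- a) (- b) by rewrite /root -hs !rmorphN /=; field.
by apply: allpairs_f; apply: rngP; rewrite normrN.
Qed.

(** * Rational values: the finite stable set, then descent *)

(** The unknowns of the linear system are the values of [I] along the list, indexed by position. *)
Lemma indefinite_root_interrobang_rational (R : realType) (I : R -> R)
  (hcont : {within `[0, 1], continuous I})
  (hrat : forall q : rat, 0 <= q <= 1 -> I (ratr q) = ratr (interrobang_rat q))
  (D : int) (x : R) : indefinite_root D x -> exists q : rat, I x = ratr q.
Proof.
move=> hx; have [s sP] := indefinite_roots_finite R D.
have gs y : y \in s -> gauss y \in s by move=> /sP/indefinite_root_gauss/sP.
have [i ->] := seq_tnthP ((sP x).2 hx).
apply: (@contracting_system_rational _ _ (fun i => I (tnth (in_tuple s) i))) => {}i.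
have ys : tnth (in_tuple s) i \in s by apply: mem_tnth.
have [j hj] := seq_tnthP (gs _ ys); have [k hk] := seq_tnthP (gs _ (gs _ ys)).
exists j, k; rewrite -hj -hk; apply: interrobang_contraction => //.
by have [] := (sP _).1 ys.
Qed.

(** Since I(x) depends on the values at G(x) and G(G(x)), the descent carries the rationality of two
    consecutive values. *)
Lemma quad_root_interrobang_rational (R : realType) (I : R -> R)
  (hcont : {within `[0, 1], continuous I})
  (hrat : forall q : rat, 0 <= q <= 1 -> I (ratr q) = ratr (interrobang_rat q))
  (a b c : int) (x : R) : irrational01 x -> a != 0 -> quad_root a b c x ->
  exists q : rat, I x = ratr q.
Proof.
suff H n : forall a b c x, (`|a| <= n)%N -> irrational01 x -> a != 0 ->
    quad_root a b c x ->
    (exists q : rat, I x = ratr q) /\ (exists q : rat, I (gauss x) = ratr q).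
  by move=> ix a0 hr; have [] := H _ _ _ _ _ (leqnn _) ix a0 hr.
have back y : irrational01 y -> (exists q : rat, I (gauss y) = ratr q) /\
    (exists q : rat, I (gauss (gauss y)) = ratr q) ->
    (exists q : rat, I y = ratr q) /\ (exists q : rat, I (gauss y) = ratr q).
  move=> iy [[q hq] [r hr]]; split; last by exists q.
  have [u [d [e [_ ->]]]] := interrobang_contraction hcont hrat iy.
  by exists (u + d * q + e * r); rewrite hq hr !rmorphD /= !rmorphM.
elim: n => [|n IH] {}a {}b {}c {}x an ix a0 hr; first by move: a0; lia.
have c0 := quad_root_coef_neq0 ix hr a0.
have hr' := quad_root_gauss ix hr; have ig := gauss_irrational01 ix.
(* If a c <= c^2, then G(x) is already a root of a form with outer coefficients of opposite
   signs. *)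
apply: (back _ ix); case: (leP (a * c) (c ^+ 2)) => ac.
  have hs := quad_root_gauss_signs ix hr c0 ac.
  have [D hd] : exists D, indefinite_root D (gauss x).
    eexists; split=> //; do 3 eexists.
    by split; [exact: hr'|exact: hs|reflexivity].
  have rat_root := indefinite_root_interrobang_rational hcont hrat.
  by split; apply: rat_root; [exact: hd|exact: indefinite_root_gauss hd].
(* Here a c > c^2 > 0 forces |c| < |a|, and c is the leading coefficient of the equation for
   G(x). *)
by apply: IH hr' => //; nia.
Qed.

(** * From rational polynomials to integer equations, and the conclusion *)

(** A vanishing quadratic coefficient would leave a nonzero polynomial of degree at most 1, whose
    roots are rational. *)
Lemma quadratic_irrational_quad_root (R : realType) (x : R) :
  quadratic_irrational x ->
  exists a b c : int, a != 0 /\ quad_root a b c x.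
Proof.
move=> [[p /andP[pn0 sp] /rootP hp] xq].
have {hp} : ratr p`_2 * x ^+ 2 + ratr p`_1 * x + ratr p`_0 = 0 :> R.
  rewrite -[RHS]hp (@horner_coef_wide _ 3) ?(leq_trans (size_poly _ _)) //.
  by rewrite !big_ord_recr big_ord0 /= !coef_map_id0 ?rmorph0 //; ring.
have pE : p = \poly_(i < 3) p`_i.
  by apply/polyP => i; rewrite coef_poly; case: ltnP => // h; rewrite nth_default // (leq_trans sp).
have : (p`_2, p`_1) != (0, 0) \/ p`_0 != 0.
  case: (eqVneq p`_0 0) => h0; last by right.
  left; apply: contraNneq pn0 => -[h2 h1]; rewrite pE; apply/eqP/polyP => i.
  by rewrite coef_poly coef0; case: i => [|[|[|]]].
move: (p`_2) (p`_1) (p`_0) => {p pn0 sp pE} u v w nz h.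
have u0 : u != 0.
  apply/eqP => u0; move: h nz; rewrite u0 rmorph0 mul0r add0r => h nz.
  have v0 : v = 0.
    apply/eqP; apply: contraT => vn0; case: xq; exists (- w / v).
    rewrite rmorphM /= fmorphV rmorphN /=.
    apply: (@mulfI _ (ratr v)); rewrite ?fmorph_eq0 // mulrCA divff ?fmorph_eq0 // mulr1.
    by apply/eqP; rewrite -addr_eq0 h.
  move: h nz; rewrite v0 rmorph0 mul0r add0r => /eqP; rewrite fmorph_eq0 => /eqP ->.
  by rewrite !eqxx; case.
have E (q : rat) : ratr q = (numq q)%:~R / (denq q)%:~R :> R by [].
have d0 (q : rat) : (denq q)%:~R != 0 :> R by rewrite intr_eq0 denq_eq0.
(* The equation is multiplied by the product of the three denominators. *)
exists (numq u * denq v * denq w), (numq v * denq u * denq w), (numq w * denq u * denq v).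
split; first by rewrite !mulf_neq0 ?denq_eq0 ?numq_eq0.
have := d0 u; have := d0 v; have := d0 w; move: h; rewrite !E /quad_root !intrM => h hw hv hu.
transitivity ((denq u)%:~R * (denq v)%:~R * (denq w)%:~R * (0 : R)); last exact: mulr0.
by rewrite -h; field; rewrite hu hv hw.
Qed.

(* I : [0,1] -> R is the (unique) continuous extension of interrobang_rat;
   we quantify over any continuous f on [0,1] agreeing with it on Q ∩ [0,1]. *)
Theorem mainTheorem15 (R : realType) (I : R -> R)
  (hcont : {within `[0, 1], continuous I})
  (hrat : forall q : rat, 0 <= q <= 1 -> I (ratr q) = ratr (interrobang_rat q))
  (x : R) (hx : 0 <= x <= 1) (hquad : quadratic_irrational x) :
  exists q : rat, I x = ratr q.
Proof.
have [a [b [c [a0 hr]]]] := quadratic_irrational_quad_root hquad.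
have [_ xq] := hquad.
apply: (quad_root_interrobang_rational hcont hrat _ a0 hr).
split=> //; move/andP: hx => [x0 x1].
rewrite !lt_neqAle x0 x1 !andbT; apply/andP; split; apply/eqP => h; apply: xq.
  by exists 0; rewrite rmorph0 -h.
by exists 1; rewrite rmorph1.
Qed.
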